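(* Assume $\diamondsuit^+$. Let $G$ be an undirected graph with $|V(G)|=\chi(G)=\omega_1$. Then there is an orientation $D^*$ of $G$ such that whenever $A\subseteq V(G)$ satisfies $\chi(G[A])=\omega_1$ and $D$ is any orientation of the half graph $H_{\omega,\omega}$, $D$ embeds (as a not necessarily induced subdigraph) into $D^*[A]$.
   Context: $\diamondsuit^+$ is the statement that there are countable families $\mathcal S_\beta\subseteq\mathcal P(\beta)$, $\beta<\omega_1$, such that for every $X\subseteq\omega_1$ there is a club $C\subseteq\omega_1$ with $X\cap\beta\in\mathcal S_\beta$ and $C\cap\beta\in\mathcal S_\beta$ for all $\beta\in C$. The half graph $H_{\omega,\omega}$ has vertex set $\omega\times 2$, and $(k,i)(\ell,j)$ is an edge iff $k\leq\ell<\omega$, $i=0$, $j=1$. An orientation of an undirected graph $G$ is a digraph on the same vertex set containing, for each edge $uv$ of $G$, exactly one of the arcs $uv$, $vu$, and no other arcs. $\chi$ is the chromatic number. *)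

(* Defs.v *)
From Stdlib Require Import Classical.

Set Implicit Arguments.

Definition countable_type (T : Type) : Prop :=
  exists f : T -> nat, forall x y, f x = f y -> x = y.

Record is_omega1 (W : Type) (lt : W -> W -> Prop) : Prop := {
  om_irrefl : forall a, ~ lt a a;
  om_trans  : forall a b c, lt a b -> lt b c -> lt a c;
  om_total  : forall a b, lt a b \/ a = b \/ lt b a;
  om_wf     : well_founded lt;
  om_uncountable : ~ countable_type W;
  om_segments_countable : forall b, countable_type {a : W | lt a b}
}.

(* Sets below beta: beta is identified with the set of its predecessors. *)
Definition restrict (W : Type) (lt : W -> W -> Prop) (X : W -> Prop) (b : W)
  : W -> Prop := fun a => X a /\ lt a b.

Definition fam_mem (T : Type) (F : (T -> Prop) -> Prop) (X : T -> Prop) : Prop :=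
  exists Y, F Y /\ forall a, Y a <-> X a.

Definition countable_family (T : Type) (F : (T -> Prop) -> Prop) : Prop :=
  exists e : nat -> (T -> Prop), forall Y, F Y -> exists n, e n = Y.

Definition unbounded (W : Type) (lt : W -> W -> Prop) (C : W -> Prop) : Prop :=
  forall a, exists c, C c /\ lt a c.

Definition closed (W : Type) (lt : W -> W -> Prop) (C : W -> Prop) : Prop :=
  forall b, (exists a, lt a b) ->
    (forall a, lt a b -> exists c, C c /\ lt a c /\ lt c b) -> C b.

Definition club (W : Type) (lt : W -> W -> Prop) (C : W -> Prop) : Prop :=
  unbounded lt C /\ closed lt C.

Definition diamond_plus (W : Type) (lt : W -> W -> Prop) : Prop :=
  exists S : W -> (W -> Prop) -> Prop,
    (forall b, countable_family (S b)) /\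
    (forall b Y, S b Y -> forall a, Y a -> lt a b) /\
    (forall X : W -> Prop, exists C : W -> Prop, club lt C /\
       forall b, C b -> fam_mem (S b) (restrict lt X b) /\
                        fam_mem (S b) (restrict lt C b)).

Definition simple_graph (V : Type) (E : V -> V -> Prop) : Prop :=
  (forall u v, E u v -> E v u) /\ (forall u, ~ E u u).

Definition orientation (V : Type) (E : V -> V -> Prop) (D : V -> V -> Prop) : Prop :=
  (forall u v, D u v -> E u v) /\
  (forall u v, E u v -> (D u v /\ ~ D v u) \/ (D v u /\ ~ D u v)).

Definition proper_colouring_on (V K : Type) (E : V -> V -> Prop) (A : V -> Prop)
  (c : V -> K) : Prop :=
  forall u v, A u -> A v -> E u v -> c u <> c v.

(* chi(G[A]) = omega_1 : G[A] has a proper colouring with omega_1 colours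
   but none with countably many (finitely or countably infinitely many)
   colours. *)
Definition chi_eq_omega1 (W V : Type) (E : V -> V -> Prop) (A : V -> Prop) : Prop :=
  (exists c : V -> W, proper_colouring_on E A c) /\
  ~ (exists c : V -> nat, proper_colouring_on E A c).

(** * The half graph H_{omega,omega} on nat * bool  (false = 0, true = 1) *)
Definition half_graph_arc (x y : nat * bool) : Prop :=
  fst x <= fst y /\ snd x = false /\ snd y = true.

Definition half_graph (x y : nat * bool) : Prop :=
  half_graph_arc x y \/ half_graph_arc y x.

Definition embeds_into (V : Type) (D : nat * bool -> nat * bool -> Prop)
  (Dstar : V -> V -> Prop) (A : V -> Prop) : Prop :=
  exists f : nat * bool -> V,
    (forall x y, f x = f y -> x = y) /\
    (forall x, A (f x)) /\
    (forall x y, D x y -> Dstar (f x) (f y)).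

(* Main.v *)
(* Work on omega_1. By recursion on b, orient the edges from b to its smaller
   neighbours by a function x_b that is Cohen generic over the countably many sets Y
   guessed by diamond+ at some d <= b. Given A of uncountable chromatic number, take
   a club of d that guess A and reflect statements with finitely many parameters
   about A; some b in A, b >= d, has infinitely many neighbours in A below d, since
   otherwise G[A] would be countably colourable. For finite F in N(b), F below d, the
   pattern x_b on F is realised by b, so by reflection by cofinally many c < d in A.
   By genericity a finite part of x_b forces this; hence, for F avoiding
   a fixed finite set l, every pattern on F is realised cofinally below d in A. Half
   graphs with arbitrary orientations are then built by alternately choosing a_n in
   N(b) \ l and b_n realising the prescribed pattern on a_0, ..., a_n. *)

From Stdlib Require Import Classical ClassicalEpsilon FunctionalExtensionality.
From Stdlib Require Import List Arith Lia Cantor.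
Require Import Defs.

(** * Choice, recursion and generic points *)

Lemma choice_fun (A B : Type) (R : A -> B -> Prop) :
  (forall x, exists y, R x y) -> exists f, forall x, R x (f x).
Proof.
  intros H.
  exists (fun x => proj1_sig (constructive_indefinite_description _ (H x))).
  intros x. apply proj2_sig.
Qed.

(** Well-founded recursion in which each value is only required to satisfy a relation. The values
    known below [b] are padded by [t0] to a total function; locality of [P] makes the padding
    harmless. *)
Lemma wf_choice (W T : Type) (lt : W -> W -> Prop) (t0 : T)
    (P : W -> (W -> T) -> T -> Prop) :
  well_founded lt ->
  (forall b f f' y, (forall a, lt a b -> f a = f' a) -> P b f y -> P b f' y) ->
  (forall b f, exists y, P b f y) ->
  exists f, forall b, P b f (f b).
Proof.
  intros wf loc ex.
  destruct (choice_fun (W * (W -> T)) T (fun u y => P (fst u) (snd u) y))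
    as [pick Hpick].
  { intros [b f]. apply ex. }
  set (extend := fun b (rec : forall a, lt a b -> T) a =>
    match excluded_middle_informative (lt a b) with
    | left h => rec a h
    | right _ => t0
    end).
  set (F := fun b rec => pick (b, extend b rec)).
  exists (Fix wf (fun _ => T) F). intros b.
  assert (Hb : Fix wf (fun _ => T) F b = F b (fun a _ => Fix wf (fun _ => T) F a)).
  { apply (Fix_eq wf (fun _ => T) F). intros a f g Hfg. f_equal.
    extensionality c. extensionality h. apply Hfg. }
  rewrite Hb.
  eapply loc; [ | apply (Hpick (b, extend b (fun a _ => Fix wf (fun _ => T) F a)))].
  intros a Hab. cbn. unfold extend.
  destruct (excluded_middle_informative (lt a b)); tauto.
Qed.

(* Baire category in [W -> bool]: countably many open sets have boundaries with
   meagre union, so some point avoids all of them. *)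
Lemma generic_point (W : Type) (Q : nat -> (W -> bool) -> Prop) :
  (forall n y, Q n y ->
     exists l, forall y', (forall a, In a l -> y' a = y a) -> Q n y') ->
  exists x, forall n, Q n x \/
     exists l, forall y, (forall a, In a l -> y a = x a) -> ~ Q n y.
Proof.
  intros Qopen.
  set (agree := fun l (y z : W -> bool) => forall a, In a l -> z a = y a).
  (* A pair [(y, l)] codes the finite condition [y] restricted to [l]. Step [n] extends the
     condition so that it decides [Q n]. *)
  destruct (choice_fun (nat * ((W -> bool) * list W)) ((W -> bool) * list W)
    (fun u v => incl (snd (snd u)) (snd v) /\
       agree (snd (snd u)) (fst (snd u)) (fst v) /\
       ((forall z, agree (snd v) (fst v) z -> Q (fst u) z) \/
        (forall z, agree (snd v) (fst v) z -> ~ Q (fst u) z)))) as [step Hstep].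
  { intros [n [y l]]; cbn.
    destruct (classic (exists y', agree l y y' /\ Q n y')) as [[y' [Hy' HQ]] | Hno].
    - destruct (Qopen n y' HQ) as [l' Hl'].
      exists (y', l ++ l'); cbn. repeat split.
      + apply incl_appl, incl_refl.
      + exact Hy'.
      + left. intros z Hz. apply Hl'. intros a Ha. apply Hz, in_or_app. now right.
    - exists (y, l); cbn. repeat split.
      + apply incl_refl.
      + right. intros z Hz HQ. apply Hno. now exists z. }
  set (s := fix s n := match n with
                       | 0 => (fun _ : W => false, nil)
                       | S m => step (m, s m)
                       end).
  assert (Hs : forall n m a, n <= m -> In a (snd (s n)) ->
            In a (snd (s m)) /\ fst (s m) a = fst (s n) a).
  { intros n m a Hnm Ha. induction Hnm as [ | m Hnm [IH1 IH2]]; [tauto | ].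
    destruct (Hstep (m, s m)) as [H1 [H2 _]]. cbn in H1, H2 |- *.
    split; [now apply H1 | ]. rewrite <- IH2. now apply H2. }
  (* [x] is the union of the increasing conditions [s n], with value [false] where none of them is
     defined. *)
  destruct (choice_fun W bool (fun a i => forall n, In a (snd (s n)) -> fst (s n) a = i))
    as [x Hx].
  { intros a. destruct (classic (exists n, In a (snd (s n)))) as [[n Hn] | Hno].
    - exists (fst (s n) a). intros m Hm.
      destruct (Nat.le_ge_cases n m) as [H | H].
      + now apply Hs.
      + symmetry. now apply Hs.
    - exists false. intros n Hn. exfalso. eauto. }
  exists x. intros n.
  destruct (Hstep (n, s n)) as [_ [_ [HQ | HQ]]]; cbn in HQ;
    change (step (n, s n)) with (s (S n)) in HQ.
  - left. apply HQ. intros a Ha. symmetry. now apply Hx.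
  - right. exists (snd (s (S n))). intros y Hy. apply HQ. intros a Ha.
    rewrite Hy by exact Ha. symmetry. now apply Hx.
Qed.

(** * Countable sets and clubs in omega_1 *)

Section Omega1.

Context {W : Type} {lt : W -> W -> Prop} (HW : is_omega1 lt).

Lemma nlt_lt_trans a b c : ~ lt b a -> lt b c -> lt a c.
Proof.
  intros H1 H2. destruct (om_total HW a b) as [H | [-> | H]]; try tauto.
  exact (om_trans HW _ _ _ H H2).
Qed.

Lemma lt_nlt_trans a b c : lt a b -> ~ lt c b -> lt a c.
Proof.
  intros H1 H2. destruct (om_total HW b c) as [H | [<- | H]]; try tauto.
  exact (om_trans HW _ _ _ H1 H).
Qed.

Lemma least (P : W -> Prop) :
  (exists a, P a) -> exists a, P a /\ forall b, P b -> ~ lt b a.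
Proof.
  intros [a Ha]. apply NNPP. intros Hno.
  induction a as [a IH] using (well_founded_ind (om_wf HW)).
  apply Hno. exists a. split; [exact Ha | ]. intros b Hb Hlt. exact (IH b Hlt Hb).
Qed.

Lemma segment_codes :
  exists e : W -> W -> nat, forall d a a', lt a d -> lt a' d -> e d a = e d a' -> a = a'.
Proof.
  apply (choice_fun W (W -> nat)
    (fun d e => forall a a', lt a d -> lt a' d -> e a = e a' -> a = a')).
  intros d. destruct (om_segments_countable HW d) as [f Hf].
  exists (fun a => match excluded_middle_informative (lt a d) with
                   | left h => f (exist _ a h)
                   | right _ => 0
                   end).
  intros a a' Ha Ha'.
  destruct (excluded_middle_informative (lt a d)) as [h | ]; [ | tauto].
  destruct (excluded_middle_informative (lt a' d)) as [h' | ]; [ | tauto].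
  intros Heq. apply Hf in Heq. exact (f_equal (@proj1_sig _ _) Heq).
Qed.

(** Otherwise every [B] is at most some [f n], so [W] is a countable union of countable initial
    segments. *)
Lemma sequence_bounded (f : nat -> W) : exists B, forall n, lt (f n) B.
Proof.
  apply NNPP. intros Hno.
  destruct (choice_fun W nat (fun B n => ~ lt (f n) B)) as [n Hn].
  { intros B. apply not_all_ex_not. intros H. apply Hno. now exists B. }
  destruct segment_codes as [e He].
  apply (om_uncountable HW).
  (* The code 0 marks [B = f (n B)]; the successor keeps the codes of smaller points apart from
     it. *)
  exists (fun B => to_nat (n B, if excluded_middle_informative (lt B (f (n B)))
                                then S (e (f (n B)) B) else 0)).
  intros a b Hab. apply to_nat_inj in Hab. injection Hab as Hnab Hab.
  rewrite <- Hnab in Hab. pose proof (Hn a) as Ha. pose proof (Hn b) as Hb.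
  rewrite <- Hnab in Hb.
  destruct (excluded_middle_informative (lt a (f (n a)))) as [h | h];
  destruct (excluded_middle_informative (lt b (f (n a)))) as [h' | h']; try discriminate.
  - injection Hab as Hab. exact (He _ _ _ h h' Hab).
  - destruct (om_total HW a (f (n a))) as [? | [-> | ?]]; try tauto.
    destruct (om_total HW b (f (n a))) as [? | [-> | ?]]; tauto.
Qed.

Lemma segment_enum d : exists s : nat -> W, forall a, lt a d -> exists n, s n = a.
Proof.
  destruct segment_codes as [e He].
  destruct (choice_fun nat W (fun n a => forall a', lt a' d -> e d a' = n -> a = a'))
    as [s Hs].
  { intros n. destruct (classic (exists a, lt a d /\ e d a = n)) as [[a [Ha <-]] | Hno].
    - exists a. intros a' Ha' Heq. symmetry in Heq. exact (He _ _ _ Ha Ha' Heq).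
    - exists d. intros a' Ha' Heq. exfalso. eauto. }
  exists s. intros a Ha. exists (e d a). now apply Hs.
Qed.

Lemma segment_bounded d (f : W -> W) : exists B, forall a, lt a d -> lt (f a) B.
Proof.
  destruct (segment_enum d) as [s Hs].
  destruct (sequence_bounded (fun n => f (s n))) as [B HB].
  exists B. intros a Ha. destruct (Hs a Ha) as [n <-]. apply HB.
Qed.

Lemma pair_bounded a b : exists c, lt a c /\ lt b c.
Proof.
  destruct (sequence_bounded (fun n => if n =? 0 then a else b)) as [B HB].
  exists B. exact (conj (HB 0) (HB 1)).
Qed.

(** Such lists are the finite parameter tuples of the statements to be reflected. The tags are
    unrestricted: they carry prescribed values of a pattern or select a closure condition. *)
Definition below (d : W) (p : list (W * bool)) : Prop :=
  Forall (fun q => lt (fst q) d) p.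

Lemma lists_bounded (h : list (W * bool) -> W) d :
  exists B, forall p, below d p -> lt (h p) B.
Proof.
  assert (Hk : forall k (h : list (W * bool) -> W), exists B, forall p, length p = k -> below d p -> lt (h p) B).
  { clear h. induction k as [ | k IH]; intros h.
    - destruct (pair_bounded (h nil) (h nil)) as [B [HB _]].
      exists B. intros [ | q p]; [auto | discriminate].
    - destruct (choice_fun (W * bool) W (fun q B => forall p, length p = k ->
        below d p -> lt (h (q :: p)) B)) as [Bq HBq].
      { intros q. apply (IH (fun p => h (q :: p))). }
      destruct (segment_bounded d (fun a => Bq (a, true))) as [B1 HB1].
      destruct (segment_bounded d (fun a => Bq (a, false))) as [B2 HB2].
      destruct (pair_bounded B1 B2) as [B [H1 H2]].
      exists B. intros [ | [a i] p] Hlen Hp; [discriminate | ].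
      inversion Hp as [ | ? ? Ha Hp']; subst. cbn in Ha.
      apply (om_trans HW _ (Bq (a, i))); [apply HBq; auto | ].
      destruct i.
      + exact (om_trans HW _ _ _ (HB1 a Ha) H1).
      + exact (om_trans HW _ _ _ (HB2 a Ha) H2). }
  destruct (choice_fun nat W (fun k B => forall p, length p = k ->
    below d p -> lt (h p) B)) as [Bk HBk]; [intros k; apply Hk | ].
  destruct (sequence_bounded Bk) as [B HB].
  exists B. intros p Hp. exact (om_trans HW _ _ _ (HBk _ p eq_refl Hp) (HB _)).
Qed.

Lemma below_weaken d d' p : lt d d' -> below d p -> below d' p.
Proof.
  intros Hd. apply Forall_impl. intros q Hq. exact (om_trans HW _ _ _ Hq Hd).
Qed.

Lemma below_cofinal (M : W -> Prop) d p :
  (exists c, M c) ->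
  (forall a, lt a d -> exists c, M c /\ lt a c) ->
  below d p -> exists c, M c /\ below c p.
Proof.
  intros [c0 Hc0] Hcof. induction 1 as [ | [a i] p Ha Hp [c [Hc Hpc]]].
  - exists c0. split; [exact Hc0 | constructor].
  - destruct (Hcof a Ha) as [c' [Hc' Hac']].
    destruct (om_total HW c c') as [H | [<- | H]].
    + exists c'. split; [exact Hc' | ]. constructor; [exact Hac' | ].
      exact (below_weaken _ _ _ H Hpc).
    + exists c. split; [exact Hc | ]. now constructor.
    + exists c. split; [exact Hc | ]. constructor; [ | exact Hpc].
      exact (om_trans HW _ _ _ Hac' H).
Qed.

(** A Löwenheim-Skolem argument. Closedness holds because a finite tuple below a limit of closure
    points already lies below one of them. *)
Lemma closing_club (h : list (W * bool) -> W) :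
  club lt (fun d => forall p, below d p -> lt (h p) d).
Proof.
  split.
  - intros a.
    destruct (choice_fun W W (fun d B => lt d B /\ forall p, below d p -> lt (h p) B))
      as [next Hnext].
    { intros d. destruct (lists_bounded h d) as [B1 HB1].
      destruct (pair_bounded d B1) as [B [H1 H2]].
      exists B. split; [exact H1 | ]. intros p Hp.
      exact (om_trans HW _ _ _ (HB1 p Hp) H2). }
    set (s := fun n => Nat.iter n next a).
    (* [d] is the supremum of the strictly increasing sequence [s], so a finite tuple below [d] lies
       below some [s n] and its value below [s (S n)]. *)
    destruct (least (fun d => forall n, lt (s n) d)) as [d [Hd Hmin]].
    { apply sequence_bounded. }
    exists d. split; [ | exact (Hd 0)].
    intros p Hp.
    destruct (below_cofinal (fun c => exists n, c = s n) d p) as [c [[n ->] Hc]].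
    + exists a. now exists 0.
    + intros b Hb. apply NNPP. intros Hno. apply (Hmin b); [ | exact Hb].
      intros n. apply NNPP. intros Hn. apply Hno. exists (s (S n)).
      split; [now exists (S n) | ].
      exact (nlt_lt_trans _ _ _ Hn (proj1 (Hnext (s n)))).
    + exact Hp.
    + exact (om_trans HW _ _ _ (proj2 (Hnext (s n)) p Hc) (Hd (S n))).
  - intros d [a0 Ha0] Hlim p Hp.
    destruct (below_cofinal (fun c => lt c d /\ forall p, below c p -> lt (h p) c) d p)
      as [c [[Hcd Hc] Hpc]].
    + destruct (Hlim a0 Ha0) as [c [H1 [H2 H3]]]. exists c. auto.
    + intros a Ha. destruct (Hlim a Ha) as [c [H1 [H2 H3]]]. exists c. auto.
    + exact Hp.
    + exact (om_trans HW _ _ _ (Hc p Hpc) Hcd).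
Qed.

(** The supremum of the members of [C] up to [b] is itself in [C]: if it were not attained, it would
    be a limit of [C]. *)
Lemma closed_max (C : W -> Prop) d0 b :
  closed lt C -> C d0 -> ~ lt b d0 ->
  exists d, C d /\ ~ lt b d /\ forall d', C d' -> ~ lt b d' -> ~ lt d d'.
Proof.
  intros Hcl H0 Hb0.
  destruct (least (fun d => forall d', C d' -> ~ lt b d' -> ~ lt d d')) as [d [Hd Hmin]].
  { exists b. auto. }
  assert (Hdb : ~ lt b d). { apply Hmin. auto. }
  exists d. repeat split; try assumption.
  apply NNPP. intros HCd. apply HCd. apply Hcl.
  - exists d0. destruct (om_total HW d0 d) as [H | [-> | H]]; [exact H | tauto | ].
    exfalso. exact (Hd d0 H0 Hb0 H).
  - intros a Ha.
    assert (Hex : exists d', C d' /\ ~ lt b d' /\ lt a d').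
    { apply NNPP. intros Hno. apply (Hmin a); [ | exact Ha].
      intros d' H1 H2 H3. apply Hno. now exists d'. }
    destruct Hex as [d' [H1 [H2 H3]]]. exists d'. repeat split; try assumption.
    destruct (om_total HW d' d) as [H | [-> | H]]; [exact H | tauto | ].
    exfalso. exact (Hd d' H1 H2 H).
Qed.

(** * Countable colourings along a club *)

Lemma list_nat_fresh (l : list nat) : exists n, ~ In n l.
Proof.
  exists (S (list_max l)). intros H.
  assert (Hall : Forall (fun k => k <= list_max l) l) by now apply list_max_le.
  rewrite Forall_forall in Hall. specialize (Hall _ H). lia.
Qed.

(* Points between consecutive elements of the club form countable blocks, coloured
   injectively; the finitely many edges of a vertex into earlier blocks are handled
   greedily. *)
Lemma countable_colouring (E : W -> W -> Prop) (A C : W -> Prop) :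
  simple_graph E -> club lt C ->
  (forall b d, A b -> C d -> ~ lt b d ->
     exists l, forall a, A a -> lt a d -> E a b -> In a l) ->
  exists c : W -> nat, proper_colouring_on E A c.
Proof.
  intros [Esym Eirr] [Hunb Hcl] Hfin.
  destruct segment_codes as [e He].
  destruct (choice_fun W W (fun b d => (C d /\ lt b d) /\
    forall d', C d' /\ lt b d' -> ~ lt d' d)) as [next Hnext].
  { intros b. apply least. apply Hunb. }
  (* [R a b] is an edge from [b] back into an earlier block: the block of [a] ends at [next a], at
     or below [b]. *)
  set (R := fun a b => A a /\ A b /\ E a b /\ lt a b /\ ~ lt b (next a)).
  assert (HR : forall b, exists l, forall a, R a b -> In a l).
  { intros b. destruct (classic (exists a0, R a0 b)) as [[a0 Ha0] | Hno].
    - destruct (Hnext a0) as [[H1 H2] _].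
      (* One [d] serves all [a]: the largest club point up to [b] bounds every [next a] with
         [R a b], so all these [a] lie below [d]. *)
      destruct (closed_max C (next a0) b Hcl H1) as [d [Hd [Hdb Hmax]]];
        [apply Ha0 | ].
      destruct (Hfin b d) as [l Hl]; [apply Ha0 | assumption | assumption | ].
      exists l. intros a [Ha [Hb [HE [Hlt Hn]]]]. destruct (Hnext a) as [[H3 H4] _].
      apply Hl; [assumption | | assumption].
      apply (lt_nlt_trans _ (next a)); [assumption | ]. now apply Hmax.
    - exists nil. intros a Ha. exfalso. eauto. }
  destruct (wf_choice W nat lt 0 (fun b f n => forall a, R a b -> f a <> n) (om_wf HW))
    as [c2 Hc2].
  { intros b f f' n Hff H a Ha. rewrite <- Hff by apply Ha. now apply H. }
  { intros b f. destruct (HR b) as [l Hl]. destruct (list_nat_fresh (map f l)) as [n Hn].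
    exists n. intros a Ha <-. apply Hn, in_map, Hl, Ha. }
  exists (fun b => to_nat (e (next b) b, c2 b)).
  assert (Hmain : forall a b, A a -> A b -> E a b -> lt a b ->
            e (next a) a = e (next b) b -> c2 a = c2 b -> False).
  { intros a b Ha Hb HE Hlt H1 H2.
    destruct (Hnext a) as [[Hca Hna] Hma]. destruct (Hnext b) as [[Hcb Hnb] Hmb].
    destruct (classic (lt b (next a))) as [Hba | Hba].
    - assert (Heq : next a = next b).
      { destruct (om_total HW (next a) (next b)) as [H | [H | H]]; [ | exact H | ].
        - exfalso. now apply (Hmb (next a)).
        - exfalso. apply (Hma (next b)); [ | exact H].
          split; [exact Hcb | ]. exact (om_trans HW _ _ _ Hlt Hnb). }
      rewrite Heq in H1, Hna. pose proof (He _ _ _ Hna Hnb H1) as ->.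
      exact (om_irrefl HW _ Hlt).
    - apply (Hc2 b a); [ | exact H2]. unfold R. auto. }
  intros a b Ha Hb HE Heq. apply to_nat_inj in Heq. injection Heq as H1 H2.
  destruct (om_total HW a b) as [H | [-> | H]].
  - exact (Hmain a b Ha Hb HE H H1 H2).
  - exact (Eirr b HE).
  - exact (Hmain b a Hb Ha (Esym _ _ HE) H (eq_sym H1) (eq_sym H2)).
Qed.

(** * The generic orientation *)

Section Orientation.

Context (E : W -> W -> Prop).

(* [x c a] decides the direction of the edge between [c] and its smaller neighbour [a]. *)
Definition pattern (X : W -> Prop) (x : W -> W -> bool) (F : list W) (y : W -> bool)
    (c : W) : Prop :=
  X c /\ forall a, In a F -> lt a c /\ E a c /\ x c a = y a.

(* Depends on [x] only below [d], which makes the recursion defining the generic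
   orientation possible. *)
Definition bounded_pattern (x : W -> W -> bool) (b d : W) (X : W -> Prop)
    (y : W -> bool) : Prop :=
  exists F r, lt r d /\
    (forall a, In a F -> X a /\ lt a d /\ E a b) /\
    forall c, lt c d -> pattern X x F y c -> ~ lt r c.

Lemma bounded_pattern_local x x' b d X y :
  (forall c, lt c d -> x c = x' c) ->
  bounded_pattern x b d X y -> bounded_pattern x' b d X y.
Proof.
  intros Hx [F [r [Hr [HF H]]]]. exists F, r.
  split; [exact Hr | ]. split; [exact HF | ].
  intros c Hc [HX HP]. apply H; [exact Hc | ]. split; [exact HX | ].
  intros a Ha. rewrite Hx by exact Hc. now apply HP.
Qed.

Lemma bounded_pattern_open x b d X y :
  bounded_pattern x b d X y ->
  exists l, forall y', (forall a, In a l -> y' a = y a) -> bounded_pattern x b d X y'.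
Proof.
  intros [F [r [Hr [HF H]]]]. exists F. intros y' Hy'. exists F, r.
  split; [exact Hr | ]. split; [exact HF | ].
  intros c Hc [HX HP]. apply H; [exact Hc | ]. split; [exact HX | ].
  intros a Ha. rewrite <- Hy' by exact Ha. now apply HP.
Qed.

(** For fixed [b], only countably many pairs [d], [Y] occur, and each gives an open set of [y]; a
    generic [x b] lies in it or has a finite part forcing out of it. These open sets mention [x]
    only below [d], hence below [b], so the recursion is legitimate. *)
Lemma generic_orientation (S : W -> (W -> Prop) -> Prop) :
  (forall d, countable_family (S d)) ->
  exists x : W -> W -> bool, forall b d Y, ~ lt b d -> S d Y ->
    bounded_pattern x b d Y (x b) \/
    exists l, forall y, (forall a, In a l -> y a = x b a) -> ~ bounded_pattern x b d Y y.
Proof.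
  intros HS.
  destruct (choice_fun W (nat -> W -> Prop)
    (fun d e => forall Y, S d Y -> exists n, e n = Y) HS) as [e He].
  apply (wf_choice W (W -> bool) lt (fun _ => false)
    (fun b f y => forall d Y, ~ lt b d -> S d Y ->
       bounded_pattern f b d Y y \/
       exists l, forall z, (forall a, In a l -> z a = y a) -> ~ bounded_pattern f b d Y z)
    (om_wf HW)).
  - intros b f f' y Hff H d Y Hd HY.
    assert (Hd' : forall c, lt c d -> f c = f' c).
    { intros c Hc. apply Hff. exact (lt_nlt_trans _ _ _ Hc Hd). }
    destruct (H d Y Hd HY) as [H1 | [l Hl]].
    + left. exact (bounded_pattern_local _ _ _ _ _ _ Hd' H1).
    + right. exists l. intros z Hz Hbad. apply (Hl z Hz).
      revert Hbad. apply bounded_pattern_local. intros c Hc. symmetry. now apply Hd'.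
  (* Any [B] above [b] gives an enumeration that includes all [d] up to [b], with [b] itself. Each
     natural number then codes an index of [d] and an index of a set in [S d]. *)
  - intros b f. destruct (pair_bounded b b) as [B [HB _]].
    destruct (segment_enum B) as [s Hs].
    destruct (generic_point W (fun n => bounded_pattern f b (s (fst (of_nat n)))
      (e (s (fst (of_nat n))) (snd (of_nat n))))) as [y Hy].
    { intros n y. apply bounded_pattern_open. }
    exists y. intros d Y Hd HY.
    destruct (Hs d (nlt_lt_trans _ _ _ Hd HB)) as [i <-].
    destruct (He _ _ HY) as [j <-].
    specialize (Hy (to_nat (i, j))). rewrite cancel_of_to in Hy. exact Hy.
Qed.

(** * Construction of half graphs *)

Lemma finite_sup (d r0 : W) (f : nat -> W) n :
  lt r0 d -> (forall k, k < n -> lt (f k) d) ->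
  exists r, lt r d /\ forall k, k < n -> ~ lt r (f k).
Proof.
  intros Hr0. induction n as [ | n IH]; intros Hf.
  - exists r0. split; [exact Hr0 | lia].
  - destruct IH as [r [Hr Hk]]; [intros k Hk; apply Hf; lia | ].
    destruct (classic (lt r (f n))) as [H | H].
    + exists (f n). split; [apply Hf; lia | ]. intros k Hkn Hlt.
      destruct (Nat.eq_dec k n) as [-> | Hne]; [exact (om_irrefl HW _ Hlt) | ].
      apply (Hk k); [lia | ]. exact (om_trans HW _ _ _ H Hlt).
    + exists r. split; [exact Hr | ]. intros k Hkn.
      destruct (Nat.eq_dec k n) as [-> | Hne]; [exact H | ]. apply Hk. lia.
Qed.

(** An edge joins [a k] and [b n] only for [k <= n], so a new [a n] merely has to be fresh, while
    [b n] realises row [n] of [eps] on the finitely many points [a 0], ..., [a n]. Taking the [b n]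
    increasing keeps them distinct. *)
Lemma half_graph_sequence (A N : W -> Prop) (x : W -> W -> bool) (d : W)
    (eps : nat -> nat -> bool) :
  (forall a, N a -> A a /\ lt a d) ->
  (forall l, exists a, N a /\ ~ In a l) ->
  (forall F y r, lt r d -> (forall a, In a F -> N a) ->
     exists c, lt c d /\ lt r c /\ pattern A x F y c) ->
  exists a b : nat -> W,
    (forall n, A (a n) /\ A (b n)) /\
    (forall j k, j < k -> a j <> a k /\ b j <> b k) /\
    (forall j k, a j <> b k) /\
    (forall k n, k <= n -> lt (a k) (b n) /\ E (a k) (b n) /\ x (b n) (a k) = eps n k).
Proof.
  intros HNA HN Hext.
  set (good := fun n (f : nat -> W * W) (u : W * W) =>
    N (fst u) /\ A (snd u) /\ lt (snd u) d /\
    (forall k, k < n -> fst (f k) <> fst u /\ fst u <> snd (f k) /\ lt (snd (f k)) (snd u)) /\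
    (forall k, k < n -> lt (fst (f k)) (snd u) /\ E (fst (f k)) (snd u) /\
       x (snd u) (fst (f k)) = eps n k) /\
    lt (fst u) (snd u) /\ E (fst u) (snd u) /\ x (snd u) (fst u) = eps n n).
  destruct (wf_choice nat (W * W) Nat.lt (d, d)
    (* The recursion must offer a value for arbitrary [f], so [good] is demanded only under these
       premises; [Hgood] discharges them by induction. *)
    (fun n f u => (forall k, k < n -> N (fst (f k)) /\ lt (snd (f k)) d) ->
       (forall j k, j < k -> k < n -> fst (f j) <> fst (f k)) -> good n f u) lt_wf)
    as [f Hf].
  { intros n f f' u Hff H H1 H2. unfold good in *.
    destruct H as [G1 [G2 [G3 [G4 [G5 G6]]]]].
    - intros k Hk. rewrite Hff by exact Hk. now apply H1.
    - intros j k Hjk Hk. rewrite !Hff by (exact Hk || (unfold Nat.lt; lia)). now apply H2.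
    - repeat split; try assumption; try apply G6; rewrite <- Hff by assumption;
        (now apply G4) || (now apply G5). }
  { intros n f. apply NNPP. intros Hno.
    assert (H1 : forall k, k < n -> N (fst (f k)) /\ lt (snd (f k)) d).
    { apply NNPP. intros H. apply Hno. exists (d, d). tauto. }
    assert (H2 : forall j k, j < k -> k < n -> fst (f j) <> fst (f k)).
    { apply NNPP. intros H. apply Hno. exists (d, d). tauto. }
    apply Hno.
    destruct (HN (map (fun k => fst (f k)) (seq 0 n) ++ map (fun k => snd (f k)) (seq 0 n)))
      as [a [Ha Hafresh]].
    assert (Hfresh : forall k, k < n -> fst (f k) <> a /\ a <> snd (f k)).
    { intros k Hk. split; intros Heq; apply Hafresh, in_or_app; [left | right];
        apply in_map_iff; exists k; (split; [now symmetry | apply in_seq; lia])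
        || (split; [assumption | apply in_seq; lia]). }
    destruct (finite_sup d a (fun k => snd (f k)) n) as [r [Hr Hrk]].
    { now apply HNA. }
    { intros k Hk. now apply H1. }
    (* [y] moves row [n] of [eps] to the points chosen so far; it is well defined because they are
       distinct. *)
    set (y := fun w => if excluded_middle_informative (w = a) then eps n n
       else if excluded_middle_informative
                 (exists k, k < n /\ fst (f k) = w /\ eps n k = true)
            then true else false).
    destruct (Hext (a :: map (fun k => fst (f k)) (seq 0 n)) y r Hr)
      as [c [Hcd [Hrc [HAc Hc]]]].
    { intros w [<- | Hw]; [exact Ha | ]. apply in_map_iff in Hw.
      destruct Hw as [k [<- Hk]]. apply in_seq in Hk. apply H1. lia. }
    exists (a, c). intros _ _. unfold good; cbn.
    assert (Hya : y a = eps n n).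
    { unfold y. destruct (excluded_middle_informative (a = a)); tauto. }
    assert (Hyk : forall k, k < n -> y (fst (f k)) = eps n k).
    { intros k Hk. unfold y.
      destruct (excluded_middle_informative (fst (f k) = a)) as [H | _].
      { now destruct (Hfresh k Hk). }
      destruct (excluded_middle_informative _) as [[j [Hj [Hjk Hjt]]] | Hnone].
      - destruct (Nat.lt_trichotomy j k) as [H | [-> | H]].
        + now destruct (H2 j k H Hk).
        + now symmetry.
        + destruct (H2 k j H Hj). now symmetry.
      - destruct (eps n k) eqn:Hek; [ | reflexivity].
        exfalso. apply Hnone. exists k. auto. }
    destruct (Hc a) as [Hc1 [Hc2 Hc3]]; [now left | ]. rewrite Hya in Hc3.
    assert (Hck : forall k, k < n -> lt (fst (f k)) c /\ E (fst (f k)) c /\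
              x c (fst (f k)) = eps n k).
    { intros k Hk. rewrite <- Hyk by exact Hk. apply Hc. right.
      apply in_map_iff. exists k. split; [reflexivity | apply in_seq; lia]. }
    split; [exact Ha | ]. split; [exact HAc | ]. split; [exact Hcd | ].
    split; [ | auto].
    intros k Hk. split; [now apply Hfresh | ]. split; [now apply Hfresh | ].
    exact (nlt_lt_trans _ _ _ (Hrk k Hk) Hrc). }
  assert (Hgood : forall n, good n f (f n)).
  { intros n. induction n as [n IH] using (well_founded_ind lt_wf). apply Hf.
    - intros k Hk. split; apply (IH k Hk).
    - intros j k Hjk Hk. now apply (IH k Hk). }
  exists (fun n => fst (f n)), (fun n => snd (f n)).
  assert (Hedge : forall k n, k <= n -> lt (fst (f k)) (snd (f n)) /\
            E (fst (f k)) (snd (f n)) /\ x (snd (f n)) (fst (f k)) = eps n k).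
  { intros k n Hkn. destruct (Hgood n) as [_ [_ [_ [_ [H1 H2]]]]].
    destruct (Nat.eq_dec k n) as [-> | Hne]; [exact H2 | ]. apply H1. lia. }
  split; [ | split; [ | split; [ | exact Hedge]]].
  - intros n. split; [apply HNA | ]; apply (Hgood n).
  - intros j k Hjk. split; [now apply (Hgood k) | ].
    intros Heq. destruct (Hgood k) as [_ [_ [_ [H _]]]].
    destruct (H j Hjk) as [_ [_ Hlt]]. rewrite Heq in Hlt.
    exact (om_irrefl HW _ Hlt).
  - intros j k. destruct (Nat.le_gt_cases j k) as [H | H].
    + intros Heq. destruct (Hedge j k H) as [Hlt _]. rewrite Heq in Hlt.
      exact (om_irrefl HW _ Hlt).
    + now apply (Hgood j).
Qed.

(** * Reflection and genericity combined *)

Lemma half_graph_patterns :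
  diamond_plus lt -> simple_graph E ->
  exists x : W -> W -> bool,
    forall A : W -> Prop, ~ (exists c : W -> nat, proper_colouring_on E A c) ->
    forall eps : nat -> nat -> bool,
    exists a b : nat -> W,
      (forall n, A (a n) /\ A (b n)) /\
      (forall j k, j < k -> a j <> a k /\ b j <> b k) /\
      (forall j k, a j <> b k) /\
      (forall k n, k <= n -> lt (a k) (b n) /\ E (a k) (b n) /\ x (b n) (a k) = eps n k).
Proof.
  intros [S [HS [_ Hguess]]] HE.
  destruct (generic_orientation S HS) as [x Hx].
  exists x. intros A HA eps.
  destruct (Hguess A) as [C [[HCunb HCcl] HC]].
  (* [q] lists a finite pattern with its values, so that a Skolem function can take it as a
     parameter. *)
  set (meets := fun (p : list (W * bool)) c =>
    A c /\ forall a i, In (a, i) p -> lt a c /\ E a c /\ x c a = i).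
  (* The tag of the head says which of the two closure conditions [h] serves. *)
  destruct (choice_fun (list (W * bool)) W (fun p w =>
    match p with
    | nil => True
    | (r, true) :: q => (exists c, lt r c /\ meets q c) -> lt r w /\ meets q w
    | (r, false) :: _ => C w /\ lt r w
    end)) as [h Hh].
  { intros [ | [r [ | ]] q].
    (* Some value is needed for the empty list: [W] is inhabited, since on an empty [W] any
       colouring is proper. *)
    - apply NNPP. intros Hno. apply HA. exists (fun _ => 0).
      intros u. exfalso. apply Hno. now exists u.
    - destruct (classic (exists c, lt r c /\ meets q c)) as [[c Hc] | Hno];
        [now exists c | now exists r].
    - apply HCunb. }
  pose proof (closing_club h) as Hclub.
  set (C' := fun d => forall p, below d p -> lt (h p) d) in Hclub.
  (* A point closed under the choice of larger members of [C] is a limit of [C]. *)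
  assert (HC' : forall d, C' d -> C d).
  { intros d Hd. apply HCcl.
    - exists (h nil). apply Hd. constructor.
    - intros a Ha. exists (h ((a, false) :: nil)).
      destruct (Hh ((a, false) :: nil)) as [H1 H2].
      repeat split; try assumption. apply Hd. now repeat constructor. }
  assert (Hinf : exists b d, A b /\ C' d /\ ~ lt b d /\
            forall l, exists a, (A a /\ lt a d /\ E a b) /\ ~ In a l).
  { apply NNPP. intros Hno. apply HA. apply (countable_colouring E A C' HE Hclub).
    intros b d Hb Hd Hbd. apply NNPP. intros Hl. apply Hno. exists b, d.
    repeat split; try assumption. intros l. apply NNPP. intros Hla. apply Hl. exists l.
    intros a Ha Had HEab. apply NNPP. intros Hal. apply Hla. now exists a. }
  destruct Hinf as [b [d [Hb [Hd [Hbd Hinf]]]]].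
  destruct (HC d (HC' d Hd)) as [[Y [HY HYA]] _].
  destruct (Hx b d Y Hbd HY) as [[F [r [Hr [HF Hbounded]]]] | [l Hl]].
  - (* [b] itself has the pattern [x b] on [F], and [d] reflects this. *)
    exfalso.
    set (q := map (fun a => (a, x b a)) F).
    assert (Hq : forall c, meets q c <-> A c /\ forall a, In a F ->
              lt a c /\ E a c /\ x c a = x b a).
    { intros c. unfold meets, q. split; intros [H1 H2]; (split; [exact H1 | ]).
      - intros a Ha. apply H2. apply in_map_iff. now exists a.
      - intros a i Hai. apply in_map_iff in Hai. destruct Hai as [a' [Heq Ha']].
        injection Heq as -> <-. now apply H2. }
    destruct (Hh ((r, true) :: q)) as [Hrw Hmeets].
    { exists b. split; [exact (lt_nlt_trans _ _ _ Hr Hbd) | ]. apply Hq.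
      split; [exact Hb | ]. intros a Ha. destruct (HF a Ha) as [_ [Had HEab]].
      repeat split; try assumption. exact (lt_nlt_trans _ _ _ Had Hbd). }
    assert (Hwd : lt (h ((r, true) :: q)) d).
    { apply Hd. constructor; [exact Hr | ]. apply Forall_forall. intros u Hu.
      apply in_map_iff in Hu. destruct Hu as [a [<- Ha]]. now apply HF. }
    apply Hq in Hmeets. apply (Hbounded _ Hwd); [ | exact Hrw].
    split; [ | apply Hmeets]. apply HYA. split; [apply Hmeets | exact Hwd].
  (* The finite part of [x b] on [l] forces unboundedness, so the points [a n] are taken from the
     infinitely many neighbours of [b] outside [l]. *)
  - apply (half_graph_sequence A (fun a => (A a /\ lt a d /\ E a b) /\ ~ In a l) x d).
    + tauto.
    + intros l'. destruct (Hinf (l ++ l')) as [a [Ha Hal]]. exists a.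
      rewrite in_app_iff in Hal. tauto.
    + intros F y r Hr HF. apply NNPP. intros Hno.
      (* This function respects the forcing condition on [l] and still equals [y] on [F], which
         avoids [l]. *)
      apply (Hl (fun a => if excluded_middle_informative (In a l) then x b a else y a)).
      { intros a Ha. destruct (excluded_middle_informative (In a l)); tauto. }
      exists F, r. split; [exact Hr | ]. split.
      { intros a Ha. destruct (HF a Ha) as [[H1 [H2 H3]] _].
        repeat split; try assumption. now apply HYA. }
      intros c Hc [HYc HP] Hrc. apply Hno. exists c.
      split; [exact Hc | ]. split; [exact Hrc | ]. split; [now apply HYA | ].
      intros a Ha. destruct (HP a Ha) as [H1 [H2 H3]].
      split; [exact H1 | ]. split; [exact H2 | ]. rewrite H3.
      destruct (excluded_middle_informative (In a l)) as [Hin | _]; [ | reflexivity].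
      now destruct (HF a Ha).
Qed.

End Orientation.

End Omega1.

(** * Transfer to the given graph *)

Theorem theorem4p8 :
  forall (W : Type) (lt : W -> W -> Prop),
    is_omega1 lt ->
    diamond_plus lt ->
    forall (V : Type) (E : V -> V -> Prop),
      simple_graph E ->
      (exists (g : V -> W) (h : W -> V),
          (forall v, h (g v) = v) /\ (forall w, g (h w) = w)) ->
      chi_eq_omega1 W E (fun _ => True) ->
      exists Dstar : V -> V -> Prop,
        orientation E Dstar /\
        forall A : V -> Prop,
          chi_eq_omega1 W E A ->
          forall D : nat * bool -> nat * bool -> Prop,
            orientation half_graph D ->
            embeds_into D Dstar A.
Proof.
  intros W lt HW Hdiamond V E [Esym Eirr] [g [h [Hhg Hgh]]] _.
  destruct (half_graph_patterns HW (fun u v => E (h u) (h v)) Hdiamond) as [x Hx].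
  { split; [intros u v; apply Esym | intros u; apply Eirr]. }
  (* The value [true] directs an edge from its smaller end to its larger end, [false] the other
     way. *)
  exists (fun u v => E u v /\ (lt (g u) (g v) /\ x (g v) (g u) = true \/
                               lt (g v) (g u) /\ x (g u) (g v) = false)).
  split.
  - split; [tauto | ]. intros u v HE. pose proof (Esym _ _ HE) as HE'.
    destruct (om_total HW (g u) (g v)) as [H | [H | H]].
    + assert (~ lt (g v) (g u)).
      { intros H'. exact (om_irrefl HW _ (om_trans HW _ _ _ H H')). }
      destruct (x (g v) (g u)); [left | right]; intuition congruence.
    + exfalso. apply (Eirr u). rewrite <- (Hhg v), <- H, Hhg in HE. exact HE.
    + assert (~ lt (g u) (g v)).
      { intros H'. exact (om_irrefl HW _ (om_trans HW _ _ _ H H')). }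
      destruct (x (g u) (g v)); [right | left]; intuition congruence.
  - intros A [_ HA] D [HD HDor].
    (* The sequence [a] will host side 0 and [b] side 1, with [a k] below [b n]; so [eps n k] must
       be [true] exactly when [D] directs the edge from side 0 to side 1. *)
    destruct (Hx (fun w => A (h w))) with (eps := fun n k =>
      if excluded_middle_informative (D (k, false) (n, true)) then true else false)
      as [a [b [HAab [Hinj [Hab Hedge]]]]].
    { intros [c Hc]. apply HA. exists (fun v : V => c (g v)). intros u v Hu Hv HE.
      apply Hc; rewrite ?Hhg; assumption. }
    assert (Hh : forall w w', h w = h w' -> w = w').
    { intros w w' H. rewrite <- (Hgh w), <- (Hgh w'). now rewrite H. }
    exists (fun u : nat * bool => h (if snd u then b (fst u) else a (fst u))). split; [ | split].
    + intros [j [ | ]] [k [ | ]] Heq; apply Hh in Heq; cbn in Heq.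
      * f_equal. destruct (Nat.lt_trichotomy j k) as [H | [H | H]]; [ | exact H | ].
        -- now destruct (Hinj j k H).
        -- destruct (Hinj k j H). congruence.
      * destruct (Hab k j). congruence.
      * destruct (Hab j k). congruence.
      * f_equal. destruct (Nat.lt_trichotomy j k) as [H | [H | H]]; [ | exact H | ].
        -- now destruct (Hinj j k H).
        -- destruct (Hinj k j H). congruence.
    + intros [n [ | ]]; apply HAab.
    + intros u v Huv. pose proof (HD u v Huv) as Hhalf.
      destruct u as [k i], v as [n j].
      destruct Hhalf as [[Hle [Hi Hj]] | [Hle [Hj Hi]]]; cbn in Hle, Hi, Hj; subst i j; cbn;
        rewrite !Hgh.
      * destruct (Hedge k n Hle) as [H1 [H2 H3]]. split; [exact H2 | ].
        left. split; [exact H1 | ]. rewrite H3.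
        destruct (excluded_middle_informative _); tauto.
      * destruct (Hedge n k Hle) as [H1 [H2 H3]]. split; [now apply Esym | ].
        right. split; [exact H1 | ]. rewrite H3.
        destruct (excluded_middle_informative _) as [H | _]; [ | reflexivity].
        destruct (HDor _ _ (HD _ _ Huv)); tauto.
Qed.
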